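(* Let $p>2$ be a prime, let $n\ge 1$ be a natural number with $n\le p-2$, and let $a_1,a_2,\ldots,a_n$ be integers. Let $(U_i)_{i\in\mathbb{Z}}$ be the integer sequence defined by $U_i=0$ for $i<0$, $U_0=1$, and $U_i+a_1U_{i-1}+a_2U_{i-2}+\cdots+a_nU_{i-n}=0$ for $i=1,2,3,\ldots$. Then the congruence $$x^n+a_1x^{n-1}+a_2x^{n-2}+\cdots+a_n\equiv 0 \pmod p,\qquad 0<x<p,$$ has $n$ roots if and only if $$U_{p-1+i-n}\equiv U_{i-n}\pmod p\quad\text{for all } i=1,2,3,\ldots.$$
   Context: ''The congruence has $n$ roots'' means that there are exactly $n$ distinct integers $x$ with $0<x<p$ satisfying it. *)

(* Defs.v *)
From mathcomp Require Import all_boot all_order all_algebra.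

Set Implicit Arguments.
Unset Strict Implicit.
Unset Printing Implicit Defensive.

Import Order.TTheory GRing.Theory Num.Theory.
Local Open Scope ring_scope.

(* Only the values a 1, ..., a n are used. *)
Definition monic_value (n : nat) (a : nat -> int) (x : int) : int :=
  x ^+ n + \sum_(1 <= k < n.+1) a k * x ^+ (n - k).

(* The integers x with 0 < x < p are represented by the nonzero elements of
   the index type 'I_p. *)
Definition congruence_roots (p n : nat) (a : nat -> int) : {set 'I_p} :=
  [set x : 'I_p | (0 < x)%N && (monic_value n a x%:Z == 0 %[mod p])%Z].

Definition is_recurrence_seq (n : nat) (a : nat -> int) (U : int -> int) : Prop :=
  [/\ forall i : int, i < 0 -> U i = 0,
      U 0 = 1
    & forall i : int, 1 <= i ->
        U i + \sum_(1 <= k < n.+1) a k * U (i - k%:Z) = 0].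

(* Main.v *)
Require Import Defs.
From HB Require Import structures.
From mathcomp Require Import all_boot all_order all_algebra all_field zify ring.

(** The idea is that both conditions say that the characteristic polynomial
    f = 'X^n + a_1 'X^(n-1) + ... + a_n, reduced mod p, divides 'X^(p-1) - 1
    over the field with p elements.

    On the side of the roots, 'X^(p-1) - 1 is the product of the 'X - x for x
    nonzero, so a monic divisor is a product of distinct such factors and has
    as many nonzero roots as its degree; conversely n distinct nonzero roots of
    f account for all of f (monic_dvdp_Xn_sub_1).

    On the side of the sequence, put V_m = U_(m+1-n), so that V starts with
    n - 1 zeros followed by a one, and let L be the linear functional on
    polynomials sending 'X^m to V_m.  The recurrence says that L kills the ideal
    of f, and the initial values make f generate the largest ideal killed by L
    (dvdp_annihilator): any h whose multiples h * 'X^i are all sent to 0 is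
    divisible by f.  For h = 'X^(p-1) - 1 the values L (h * 'X^i) are the
    differences V_(p-1+i) - V_i, so divisibility is exactly the periodicity of
    V, which is the congruence condition on U. *)

Set Implicit Arguments.
Unset Strict Implicit.
Unset Printing Implicit Defensive.

Import Order.TTheory GRing.Theory Num.Theory.
Local Open Scope ring_scope.

(** * The functional of a sequence and its annihilator *)

Section SeqFunctional.
Variables (F : fieldType) (V : nat -> F).

Definition seq_functional (h : {poly F}) : F := \sum_(k < size h) h`_k * V k.

Lemma seq_functional_widen N (h : {poly F}) :
  (size h <= N)%N -> seq_functional h = \sum_(k < N) h`_k * V k.
Proof.
move=> leN; rewrite /seq_functional (big_ord_widen N (fun k => h`_k * V k)) //.
rewrite big_mkcond /=; apply: eq_bigr => k _.
by case: ltnP => // le_hk; rewrite nth_default // mul0r.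
Qed.

Lemma seq_functional_is_scalar : scalar seq_functional.
Proof.
move=> c g h; pose N := maxn (size (c *: g + h)%R) (maxn (size g) (size h)).
have [leN leNg leNh] : [/\ size (c *: g + h)%R <= N, size g <= N & size h <= N]%N.
  by rewrite /N !leq_max !leqnn !orbT.
rewrite !(@seq_functional_widen N) // mulr_sumr -big_split /=.
by apply: eq_bigr => k _; rewrite coefD coefZ mulrDl mulrA.
Qed.

HB.instance Definition _ :=
  GRing.isLinear.Build F {poly F} F *%R seq_functional seq_functional_is_scalar.

Lemma seq_functionalXn m : seq_functional 'X^m = V m.
Proof.
rewrite /seq_functional size_polyXn big_ord_recr /= coefXn eqxx mul1r big1 ?add0r //.
by move=> k _; rewrite coefXn (ltn_eqF (ltn_ord k)) mul0r.
Qed.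

End SeqFunctional.

(** If a nonzero remainder r modulo f satisfied the right-hand condition, then
    shifting r to degree n would leave L with the leading coefficient of r
    alone, times the nonzero value L 'X^n. *)
Lemma dvdp_annihilator (F : fieldType) (L : {scalar {poly F}}) (n : nat)
    (f h : {poly F}) :
    size f = n.+2 -> (forall m, L (f * 'X^m) = 0) ->
    (forall m, (m < n)%N -> L 'X^m = 0) -> L 'X^n != 0 ->
  f %| h <-> (forall i, L (h * 'X^i) = 0).
Proof.
move=> size_f Lf L0 Ln.
have Lsum (g q : {poly F}) : L (g * q) = \sum_(i < size q) q`_i * L (g * 'X^i).
  rewrite -[q in LHS]coefK poly_def mulr_sumr linear_sum /=.
  by apply: eq_bigr => i _; rewrite -scalerAr linearZ.
have Lf0 q : L (f * q) = 0 by rewrite Lsum big1 // => i _; rewrite Lf mulr0.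
split=> [/dvdpP[q ->] i | Lh]; first by rewrite mulrAC mulrC Lf0.
apply/negPn/negP; rewrite /dvdp => r_neq0; set r : {poly F} := h %% f in r_neq0.
have lt_rf : (size r <= n.+1)%N.
  by rewrite -ltnS -size_f ltn_modp -size_poly_eq0 size_f.
have Lr i : L (r * 'X^i) = 0.
  have := Lh i; rewrite {1}(divp_eq h f) -/r mulrDl linearD /=.
  by rewrite mulrAC mulrC Lf0 add0r.
have r_gt0 : (0 < size r)%N by rewrite size_poly_gt0.
have /eqP := Lr (n.+1 - size r)%N; rewrite mulrC Lsum -(prednK r_gt0) big_ord_recr /=.
rewrite prednK // -exprD big1 ?add0r => [|i _]; last first.
  rewrite -exprD L0 ?mulr0 //; have := ltn_ord i.
  by move: (size r) lt_rf r_gt0 (nat_of_ord i); lia.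
have -> : (n.+1 - size r + (size r).-1 = n)%N by lia.
by rewrite mulf_eq0 (negPf Ln) orbF -/(lead_coef r) lead_coef_eq0 (negPf r_neq0).
Qed.

(** * Divisors of 'X^(q-1) - 1 over a field with q elements *)

Lemma finField_Xn_sub_1 (F : finFieldType) :
  'X^(#|F|.-1) - 1 = \prod_(x <- enum (predC1 (0 : F))) ('X - x%:P) :> {poly F}.
Proof.
have F_gt0 : (0 < #|F|)%N by apply/card_gt0P; exists 0.
apply: (@mulfI _ 'X); first by rewrite polyX_eq0.
rewrite mulrBr mulr1 -exprS prednK // finField_genPoly (bigD1 0) //= subr0.
by rewrite big_enum.
Qed.

Lemma monic_dvdp_Xn_sub_1 (F : finFieldType) (f : {poly F}) :
  f \is monic ->
  f %| 'X^(#|F|.-1) - 1 <-> #|[set x | (x != 0) && root f x]| = (size f).-1.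
Proof.
move=> f_monic; set A := [set x | _].
have f_gt0 : (0 < size f)%N by rewrite size_poly_gt0 monic_neq0.
rewrite finField_Xn_sub_1; split=> [|cardA].
  case/dvdp_prod_XsubC=> m; rewrite eqp_monic ?monic_prod_XsubC // => /eqP def_f.
  set rs := mask m _ in def_f.
  have uniq_rs : uniq rs by rewrite mask_uniq ?enum_uniq.
  have -> : #|A| = #|rs|.
    apply: eq_card => x; rewrite inE def_f root_prod_XsubC andb_idl //.
    by move/mem_mask; rewrite mem_enum.
  by rewrite (card_uniqP uniq_rs) def_f size_prod_XsubC.
have allA : all (root f) (enum A).
  by apply/allP=> x; rewrite mem_enum inE => /andP[].
have -> : f = \prod_(x <- enum A) ('X - x%:P).
  rewrite [LHS](@all_roots_prod_XsubC _ f (enum A)) ?uniq_rootsE ?enum_uniq //.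
    by rewrite (monicP f_monic) scale1r.
  by rewrite -cardE cardA prednK.
apply: uniq_roots_dvdp; last by rewrite uniq_rootsE enum_uniq.
apply/allP=> x; rewrite mem_enum inE root_prod_XsubC mem_enum => /andP[x_neq0 _].
exact: x_neq0.
Qed.

(** * Reduction modulo p *)

Lemma eqz_mod_Fp (p : nat) (x y : int) : prime p ->
  (x = y %[mod p])%Z <-> x%:~R = y%:~R :> 'F_p.
Proof.
move=> p_pr; rewrite (rwP eqP) eqz_mod_dvd (dvdz_pcharf (pchar_Fp p_pr)).
by rewrite rmorphB subr_eq0 (rwP eqP).
Qed.

Definition char_poly_rec (R : nzRingType) (n : nat) (a : nat -> int) : {poly R} :=
  'X^n + \sum_(1 <= k < n.+1) (a k)%:~R *: 'X^(n - k).

Lemma size_char_poly_rec_tail (R : nzRingType) n a :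
  (size (\sum_(1 <= k < n.+1) (a k)%:~R *: 'X^(n - k) : {poly R})%R <= n)%N.
Proof.
rewrite big_add1 /= big_mkord; apply: (leq_trans (size_sum _ _ _)).
apply/bigmax_leqP => i _.
apply: (leq_trans (size_scale_leq _ _)); rewrite size_polyXn.
by rewrite ltn_subrL (leq_ltn_trans _ (ltn_ord i)).
Qed.

Lemma size_char_poly_rec (R : nzRingType) n a : size (char_poly_rec R n a) = n.+1.
Proof. by rewrite size_polyDl size_polyXn // ltnS size_char_poly_rec_tail. Qed.

Lemma char_poly_rec_monic (R : nzRingType) n a : char_poly_rec R n a \is monic.
Proof.
rewrite monicE lead_coefDl ?lead_coefXn //.
by rewrite size_polyXn ltnS size_char_poly_rec_tail.
Qed.

Lemma horner_char_poly_rec (R : comNzRingType) n a (x : int) :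
  (char_poly_rec R n a).[x%:~R] = (monic_value n a x)%:~R.
Proof.
rewrite hornerD hornerXn rmorphD rmorphXn rmorph_sum horner_sum; congr (_ + _).
by apply: eq_bigr => k _; rewrite hornerZ hornerXn rmorphM rmorphXn.
Qed.

Lemma card_congruence_roots (p n : nat) (a : nat -> int) : prime p ->
  #|congruence_roots p n a|
    = #|[set x : 'F_p | (x != 0) && root (char_poly_rec _ n a) x]|.
Proof.
move=> p_pr; pose red (x : 'I_p) : 'F_p := x%:R.
have val_red x : red x = x :> nat by rewrite val_Fp_nat // modn_small.
have red_inj : injective red.
  by move=> x y eq_xy; apply: val_inj; rewrite /= -!val_red eq_xy.
rewrite -(card_imset _ red_inj); apply: eq_card => y; rewrite inE.
have lt_yp : (y < p)%N by rewrite -[X in (_ < X)%N](Fp_cast p_pr).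
have def_y : red (Ordinal lt_yp) = y by rewrite /red natr_Zp.
rewrite -[in LHS]def_y mem_imset // inE /= -lt0n; congr (_ && _).
rewrite -[X in root _ X]def_y rootE -[red _]/(y%:Z%:~R) horner_char_poly_rec.
by apply/eqP/eqP=> /(@eqz_mod_Fp p _ 0 p_pr).
Qed.

(** Killing f * 'X^m is the recurrence at the index m + 1, once U is reindexed
    to start at 1 - n; this start is the earliest term which the recurrence
    involves, as it holds from the index 1 on. *)
Lemma seq_functional_recurrence (R : fieldType) n a U : is_recurrence_seq n a U ->
  forall m, seq_functional (fun k => (U (k%:Z + 1 - n%:Z))%:~R)
              (char_poly_rec R n a * 'X^m) = 0.
Proof.
case=> _ _ U_rec m; rewrite mulrDl mulr_suml linearD linear_sum /=.
rewrite -exprD seq_functionalXn.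
have := U_rec (m%:Z + 1); rewrite lerDr => /(_ isT) /(congr1 (intr : int -> R)).
rewrite rmorphD rmorph_sum rmorph0 => U_rec_m.
rewrite -[RHS]U_rec_m; congr (_%:~R + _).
  by congr (U _); rewrite PoszD; ring.
apply: eq_big_nat => k /andP[_ le_kn].
rewrite -scalerAl linearZ /= -exprD seq_functionalXn rmorphM; congr (_ * (U _)%:~R).
rewrite PoszD -subzn //; ring.
Qed.

Theorem theorem2p1 (p n : nat) (a : nat -> int) (U : int -> int)
    (p_gt2 : (2 < p)%N) (p_prime : prime p)
    (n_ge1 : (1 <= n)%N) (n_le : (n <= p - 2)%N)
    (U_rec : is_recurrence_seq n a U) :
  #|congruence_roots p n a| = n <->
  (forall i : int, 1 <= i ->
     (U (p%:Z - 1 + i - n%:Z) = U (i - n%:Z) %[mod p])%Z).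
Proof.
case: n n_ge1 n_le U_rec => // n _ n_le U_rec.
have [U_neg U_0 _] := U_rec.
pose f := char_poly_rec 'F_p n.+1 a.
pose V k : 'F_p := (U (k%:Z + 1 - n.+1%:Z))%:~R.
have V0 m : (m < n)%N -> seq_functional V 'X^m = 0.
  by move=> lt_mn; rewrite seq_functionalXn /V U_neg // subr_lt0 -PoszD addn1.
have Vn : seq_functional V 'X^n != 0.
  by rewrite seq_functionalXn /V -PoszD addn1 subrr U_0 oner_eq0.
have dvd_roots := monic_dvdp_Xn_sub_1 (char_poly_rec_monic 'F_p n.+1 a).
rewrite card_Fp // size_char_poly_rec /= in dvd_roots.
rewrite card_congruence_roots // -dvd_roots.
rewrite (dvdp_annihilator _ (size_char_poly_rec _ _ _)
  (seq_functional_recurrence _ U_rec) V0 Vn) /=.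
have LE i : seq_functional V (('X^(p.-1) - 1) * 'X^i) = V (p.-1 + i)%N - V i.
  by rewrite mulrBl mul1r linearB /= -exprD !seq_functionalXn.
have VE i : V (p.-1 + i)%N = (U (p%:Z - 1 + i.+1%:Z - n.+1%:Z))%:~R.
  congr (U (_ - _))%:~R; rewrite -PoszD addn1 -addnS PoszD.
  by rewrite -subn1 -subzn // prime_gt0.
have VE' i : V i = (U (i.+1%:Z - n.+1%:Z))%:~R by rewrite /V -PoszD addn1.
split=> [LV [[|i] | i] // _ | Uper i].
  by apply/eqz_mod_Fp => //; rewrite -VE -VE'; apply/eqP; rewrite -subr_eq0 -LE LV.
by rewrite LE VE VE'; apply/eqP; rewrite subr_eq0; apply/eqP/eqz_mod_Fp => //; apply: Uper.
Qed.
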